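(* Let $F$ be a field of characteristic $\neq 2,3$ such that $-1\in F^2$ (i.e. $-1$ is a square in $F$), let $(A,\bar{\ })$ be a structurable algebra over $F$, and let $\mathfrak d$ be a Lie subalgebra of $\mathfrak{der}(A,\bar{\ })$ containing the inner derivations $\mathfrak{inder}(A,\bar{\ })$. Then $\mathrm{Aut}\bigl(\mathcal K(A,\bar{\ },\mathfrak d)\bigr)$ contains a subgroup isomorphic to the symmetric group of degree $4$.
   Context: A structurable algebra $(A,\bar{\ })$ is a nonzero unital (not necessarily associative) algebra with involution (multiplication by juxtaposition, $\bar{\bar x}=x$, $\overline{xy}=\bar y\bar x$) such that, with $V_{x,y}(z)=(x\bar y)z+(z\bar y)x-(z\bar x)y$, one has $[V_{x,y},V_{z,w}]=V_{V_{x,y}(z),w}-V_{z,V_{y,x}(w)}$ for all $x,y,z,w\in A$. Let $L_x,R_x$ denote left and right multiplications, $\mathfrak{gl}(A)$ the Lie algebra of linear endomorphisms of $A$, $(x,y,z)=(xy)z-x(yz)$ the associator, $[x,y]=xy-yx$, and $S=\{x\in A:\bar x=-x\}$. $\mathfrak{der}(A,\bar{\ })$ is the Lie algebra of derivations of $A$ commuting with the involution, and $\mathfrak{inder}(A,\bar{\ })$ is its ideal spanned by the derivations $D_{x,y}(z)=\frac13\bigl[[x,y]+[\bar x,\bar y],z\bigr]+(z,y,x)-(z,\bar x,\bar y)$, $x,y\in A$. Kantor's construction: put $T_x=V_{x,1}$ and $T_A=\{T_x:x\in A\}$. As a vector space $\mathcal K(A,\bar{\ },\mathfrak d)=\tilde{\mathfrak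 n}\oplus(T_A\oplus\mathfrak d)\oplus\mathfrak n$, where $\mathfrak n=A\times S$ and $\tilde{\mathfrak n}$ is another copy of $\mathfrak n$, whose elements are written $(x,s)^{\sim}$. $T_A\oplus\mathfrak d$ is a Lie subalgebra of $\mathfrak{gl}(A)$, and the bracket of two of its elements in $\mathcal K(A,\bar{\ },\mathfrak d)$ is their bracket in $\mathfrak{gl}(A)$. For $x,y\in A$, $r,s\in S$, $f\in T_A\oplus\mathfrak d$ the remaining brackets are $[f,(x,s)]=(f(x),f^\delta(s))$, $[f,(x,s)^\sim]=(f^\epsilon(x),f^{\epsilon\delta}(s))^\sim$, $[(x,r),(y,s)]=(0,x\bar y-y\bar x)$, $[(x,r)^\sim,(y,s)^\sim]=(0,x\bar y-y\bar x)^\sim$, $[(x,r),(y,s)^\sim]=-(sx,0)^\sim+V_{x,y}+L_rL_s+(ry,0)$, where $f^\epsilon=f-T_{f(1)+\overline{f(1)}}$, $f^\delta=f+R_{\overline{f(1)}}$ and $f^{\epsilon\delta}=(f^\epsilon)^\delta$. This is a Lie algebra over $F$. *)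

(* Defs.v *)
From HB Require Import structures.
From mathcomp Require Import all_boot all_fingroup all_algebra.
From mathcomp Require Import all_classical.
Set Implicit Arguments.
Unset Strict Implicit.
Unset Printing Implicit Defensive.
Import GRing.Theory.
Local Open Scope classical_set_scope.
Local Open Scope ring_scope.

Reserved Notation "x ** y" (at level 40, left associativity).

(* A reflexive decision procedure for linear identities over a zmodType, used
   only to check below that the bracket of Kantor's construction is well
   defined. *)
Module ZmodTactic.

Inductive zexp := ZX of nat | Z0 | ZD of zexp & zexp | ZN of zexp
  | ZM of zexp & nat.

Fixpoint zval (V : zmodType) (env : seq V) e : V := match e with
  | ZX n => env`_n
  | Z0 => 0
  | ZD a b => zval env a + zval env b
  | ZN a => - zval env a
  | ZM a n => zval env a *+ n
  end.

Fixpoint zcoef (i : nat) e : int := match e with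
  | ZX n => (n == i)%:Z
  | Z0 => 0
  | ZD a b => zcoef i a + zcoef i b
  | ZN a => - zcoef i a
  | ZM a n => zcoef i a * n%:Z
  end.

Lemma zvalE (V : zmodType) (env : seq V) e :
  zval env e = \sum_(i < size env) env`_i *~ zcoef i e.
Proof.
elim: e => [n||a iha b ihb|a iha|a iha n] /=.
- have [ltn|gen] := ltnP n (size env).
    rewrite (bigD1 (Ordinal ltn)) //= eqxx mulr1z big1 ?addr0 // => i.
    by rewrite -val_eqE /= eq_sym => /negPf ->; rewrite mulr0z.
  rewrite nth_default // big1 // => i _.
  by rewrite gtn_eqF ?mulr0z // (leq_trans (ltn_ord i) gen).
- by rewrite big1 // => i _; rewrite mulr0z.
- by rewrite iha ihb -big_split /=; apply: eq_bigr => i _; rewrite mulrzDr.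
- by rewrite iha -sumrN; apply: eq_bigr => i _; rewrite mulrNz.
- by rewrite iha -sumrMnl; apply: eq_bigr => i _; rewrite mulrzA pmulrn.
Qed.

Lemma zval_eq (V : zmodType) (env : seq V) a b :
  all (fun i => zcoef i a == zcoef i b) (iota 0 (size env)) ->
  zval env a = zval env b.
Proof.
move=> /allP h; rewrite !zvalE; apply: eq_bigr => i _; congr (_ *~ _).
by apply/eqP/h; rewrite mem_iota /= add0n ltn_ord.
Qed.

Ltac index x env := match env with
  | ?y :: _ => let _ := match goal with _ => unify x y end in constr:(0%N)
  | _ :: ?e => let n := index x e in constr:(S n)
  end.
Ltac add x env := match env with
  | _ => let _ := index x env in env
  | _ => constr:(x :: env)
  end.
Ltac atoms t env := match t with
  | 0 => env
  | ?a + ?b => let e := atoms a env in atoms b e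
  | - ?a => atoms a env
  | ?a *+ ?n => atoms a env
  | _ => add t env
  end.
Ltac reify t env := match t with
  | 0 => constr:(Z0)
  | ?a + ?b => let x := reify a env in let y := reify b env in constr:(ZD x y)
  | - ?a => let x := reify a env in constr:(ZN x)
  | ?a *+ ?n => let x := reify a env in constr:(ZM x n)
  | _ => let n := index t env in constr:(ZX n)
  end.
Ltac zmod := match goal with |- @eq ?T ?a ?b =>
  let e := atoms a (@nil T) in let e := atoms b e in
  let x := reify a e in let y := reify b e in
  apply: (@zval_eq _ e x y); by vm_compute end.

End ZmodTactic.
Import ZmodTactic.

HB.mixin Record isInvAlgebra (F : fieldType) A of GRing.Lmodule F A := {
  nmul : A -> A -> A;
  none : A;
  bar : A -> A;
  nmul_linearl : forall y, linear (nmul^~ y);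
  nmul_linearr : forall x, linear (nmul x);
  nmul1x : left_id none nmul;
  nmulx1 : right_id none nmul;
  none_neq0 : none != 0;
  bar_linear : linear bar;
  barK : involutive bar;
  barM : forall x y, bar (nmul x y) = nmul (bar y) (bar x)
}.

#[short(type="invAlgebraType")]
HB.structure Definition InvAlgebra (F : fieldType) :=
  {A of isInvAlgebra F A & GRing.Lmodule F A}.

Arguments none {F s}.
Notation "x ** y" := (nmul x y) : ring_scope.

Section Operators.
Variables (F : fieldType) (A : invAlgebraType F).
Implicit Types (x y z : A) (f g : A -> A) (d h : set (A -> A)).

Definition assoc x y z := (x ** y) ** z - x ** (y ** z).
Definition ncomm x y := x ** y - y ** x.
Definition Lop x : A -> A := fun y => x ** y.
Definition Rop x : A -> A := fun y => y ** x.
Definition Vop x y : A -> A := fun z =>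
  (x ** bar y) ** z + (z ** bar y) ** x - (z ** bar x) ** y.
Definition Top x := Vop x none.

Definition gl_bracket f g : A -> A := (f \o g) - (g \o f).

Definition gl : set (A -> A) := [set f | linear f].

Record lie_subalgebra h d : Prop := LieSubalgebra {
  lie_sub : d `<=` h;
  lie_sub0 : d 0;
  lie_sub_linear : forall a f g, d f -> d g -> d (a *: f + g);
  lie_sub_bracket : forall f g, d f -> d g -> d (gl_bracket f g)
}.

Definition der : set (A -> A) := [set D | [/\ gl D,
  forall x y, D (x ** y) = D x ** y + x ** D y &
  forall x, D (bar x) = bar (D x)]].

Definition Dop x y : A -> A := fun z =>
  3%:R^-1 *: ncomm (ncomm x y + ncomm (bar x) (bar y)) z
  + assoc z y x - assoc z (bar x) (bar y).

Definition inder : set (A -> A) := [set f |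
  exists s : seq (F * A * A), f = \sum_(t <- s) t.1.1 *: Dop t.1.2 t.2].

Definition eps f : A -> A := f - Top (f none + bar (f none)).
Definition del f : A -> A := f + Rop (bar (f none)).

Definition skewp : {pred A} := [pred s | bar s == - s].

(* T_A + d; the sum is direct when the characteristic is not 3, since
   T_x 1 = 2 x - bar x while derivations kill 1 *)
Definition TD d : set (A -> A) :=
  [set f | exists x, exists2 D, d D & f = Top x + D].

End Operators.

Arguments gl {F} A _.
Arguments der {F} A _.
Arguments inder {F} A _.
Arguments skewp {F} A _.

HB.mixin Record isStructurable (F : fieldType) A of InvAlgebra F A := {
  structurable_axiom : forall x y z w : A,
    gl_bracket (Vop x y) (Vop z w)
    = Vop (Vop x y z) w - Vop z (Vop y x w)
}.

#[short(type="structurableType")]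
HB.structure Definition Structurable (F : fieldType) :=
  {A of isStructurable F A & InvAlgebra F A}.

Section Arithmetic.
Variables (F : fieldType) (A : invAlgebraType F).
Implicit Types (x y z : A).

HB.instance Definition _ y := GRing.isLinear.Build F A A *:%R (Rop y)
  (nmul_linearl y).
HB.instance Definition _ x := GRing.isLinear.Build F A A *:%R (Lop x)
  (nmul_linearr x).
HB.instance Definition _ := GRing.isLinear.Build F A A *:%R (@bar F A)
  (@bar_linear F A).

Lemma nmulDl x y z : (x + y) ** z = x ** z + y ** z.
Proof. exact: (raddfD (Rop z)). Qed.
Lemma nmulDr x y z : z ** (x + y) = z ** x + z ** y.
Proof. exact: (raddfD (Lop z)). Qed.
Lemma nmulNl x z : (- x) ** z = - (x ** z).
Proof. exact: (raddfN (Rop z)). Qed.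
Lemma nmulNr x z : z ** (- x) = - (z ** x).
Proof. exact: (raddfN (Lop z)). Qed.
Lemma nmulZl a x z : (a *: x) ** z = a *: (x ** z).
Proof. exact: (linearZZ (Rop z)). Qed.
Lemma nmulZr a x z : z ** (a *: x) = a *: (z ** x).
Proof. exact: (linearZZ (Lop z)). Qed.
Lemma nmulMnl x z n : (x *+ n) ** z = (x ** z) *+ n.
Proof. exact: (raddfMn (Rop z)). Qed.
Lemma nmulMnr x z n : z ** (x *+ n) = (z ** x) *+ n.
Proof. exact: (raddfMn (Lop z)). Qed.
Lemma nmul0x z : 0 ** z = 0.
Proof. exact: (raddf0 (Rop z)). Qed.
Lemma nmulx0 z : z ** 0 = 0.
Proof. exact: (raddf0 (Lop z)). Qed.
Lemma barD x y : bar (x + y) = bar x + bar y. Proof. exact: raddfD. Qed.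
Lemma barN x : bar (- x) = - bar x. Proof. exact: raddfN. Qed.
Lemma barZ a x : bar (a *: x) = a *: bar x. Proof. exact: linearZZ. Qed.
Lemma barMn x n : bar (x *+ n) = bar x *+ n. Proof. exact: raddfMn. Qed.
Lemma bar1 : bar (none : A) = none.
Proof. by rewrite -[LHS]nmul1x -{1}[none]barK -barM nmul1x barK. Qed.

Definition nmulE := (nmulDl, nmulDr, nmulNl, nmulNr, nmulMnl, nmulMnr,
  @nmul1x F A, @nmulx1 F A, nmul0x, nmulx0).
Definition barE := (barD, barN, barMn, bar1, @barM F A, @barK F A).

Lemma addfE (f g : A -> A) x : (f + g) x = f x + g x. Proof. by []. Qed.
Lemma scalefE a (f : A -> A) x : (a *: f) x = a *: f x. Proof. by []. Qed.
Lemma oppfE (f : A -> A) x : (- f) x = - f x. Proof. by []. Qed.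
Lemma glE (f g : A -> A) x : gl_bracket f g x = f (g x) - g (f x).
Proof. by []. Qed.

Lemma subr_eq_trans (V : zmodType) (a b u v : V) :
  u = v -> a - b = u - v -> a = b.
Proof. by move=> -> /eqP; rewrite subrr subr_eq0 => /eqP. Qed.

Lemma Top_linear x y a : Top (a *: x + y) = a *: Top x + Top y.
Proof.
apply/funext => z; rewrite addfE scalefE /Top /Vop bar1 !nmulx1 barD barZ.
rewrite !(nmulDl, nmulDr, nmulZl, nmulZr) !scalerDr scalerN.
zmod.
Qed.

Lemma skewP s : reflect (bar s = - s) (s \in skewp A).
Proof. exact: eqP. Qed.

Lemma skew_submod : subsemimod_closed (skewp A).
Proof.
split=> [|a s /skewP hs]; last by apply/skewP; rewrite barZ hs scalerN.
split=> [|s t /skewP hs /skewP ht]; apply/skewP.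
  by rewrite raddf0 oppr0.
by rewrite barD hs ht opprD.
Qed.

Lemma psi_skew x y : x ** bar y - y ** bar x \in skewp A.
Proof. by apply/skewP; rewrite !barE; zmod. Qed.

End Arithmetic.


Section TD.
Variables (F : fieldType) (A : structurableType F).
Variable d : set (A -> A).
Hypotheses (char2 : 2%N \notin [pchar F]) (char3 : 3%N \notin [pchar F]).
Hypotheses (d_sub : lie_subalgebra (der A) d) (d_inder : inder A `<=` d).
Implicit Types (x y z r s : A) (f g D : A -> A).

Lemma Top0 : Top (0 : A) = 0.
Proof.
by have := Top_linear (0 : A) 0 (-1); rewrite scaler0 addr0 scaleN1r addNr.
Qed.

Lemma TD_linear a f g : TD d f -> TD d g -> TD d (a *: f + g).
Proof.
move=> [x [D dD ->]] [y [E dE ->]].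
exists (a *: x + y); exists (a *: D + E).
  exact: lie_sub_linear d_sub _ _ _ dD dE.
by rewrite Top_linear scalerDr addrACA.
Qed.

Lemma TD0 : TD d 0.
Proof.
by exists 0; exists 0; [exact: lie_sub0 d_sub | rewrite Top0 addr0].
Qed.

Lemma TDD f g : TD d f -> TD d g -> TD d (f + g).
Proof. by move=> hf hg; rewrite -[f]scale1r; apply: TD_linear. Qed.

Lemma TDZ a f : TD d f -> TD d (a *: f).
Proof. by move=> hf; rewrite -[_ *: f]addr0; apply/TD_linear/TD0. Qed.

Lemma TDN f : TD d f -> TD d (- f).
Proof. by move=> hf; rewrite -scaleN1r; apply: TDZ. Qed.

Lemma TDT x : TD d (Top x).
Proof. by exists x; exists 0; [exact: lie_sub0 d_sub | rewrite addr0]. Qed.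

Lemma TDd D : d D -> TD d D.
Proof. by move=> dD; exists 0; exists D => //; rewrite Top0 add0r. Qed.

Lemma der1 D : d D -> D none = 0.
Proof.
move=> /(lie_sub d_sub) [_ /(_ none none) + _].
by rewrite !(nmul1x, nmulx1) => h; apply: (addrI (D none)); rewrite addr0 -h.
Qed.

Lemma derD D x y : d D -> D (x + y) = D x + D y.
Proof.
by move=> /(lie_sub d_sub) [/(_ 1 x y)+ _ _]; rewrite !scale1r.
Qed.

Lemma derN D x : d D -> D (- x) = - D x.
Proof.
move=> dD; apply/eqP; rewrite -addr_eq0 -derD // addNr; apply/eqP.
by apply: (addrI (D 0)); rewrite -derD // !addr0.
Qed.

Lemma pchar_neq0 n : n \notin [pchar F] -> prime n -> n%:R != 0 :> F.
Proof. by move=> + pn; apply: contra => n0; rewrite inE pn n0. Qed.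

Lemma eps_TD f : TD d f -> TD d (eps f).
Proof. by move=> hf; apply: TDD => //; apply/TDN/TDT. Qed.

Lemma del_skew f s : TD d f -> s \in skewp A -> del f s \in skewp A.
Proof.
move=> [x [D dD ->]] /skewP hs; apply/skewP.
have [_ _ Db] := lie_sub d_sub dD.
have hD : bar (D s) = - D s by rewrite -Db hs derN.
rewrite /del !addfE (der1 dD) addr0 /Rop /Top /Vop.
by rewrite !(barE, nmulE) hD hs !nmulE; zmod.
Qed.

Lemma TD_V x y : TD d (Vop x y).
Proof.
have n3 := pchar_neq0 char3 isT.
set c := ncomm x (bar y) + ncomm (bar x) y; pose u := 3%:R^-1 *: c.
have u3 : u *+ 3 = c by rewrite /u -scaler_nat scalerA mulfV // scale1r.
have bu : bar u = - u.
  by rewrite /u barZ /c /ncomm -scalerN !barE; congr (_ *: _); zmod.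
exists (x ** bar y - u); exists (Dop x (bar y)).
  apply: d_inder; exists [:: (1, x, bar y)].
  by rewrite big_seq1 /= scale1r.
apply/funext => z; rewrite addfE /Dop barK -/c /ncomm.
rewrite scalerBr -nmulZl -nmulZr -/u.
have := congr1 (fun t => z ** t) u3; rewrite /c /ncomm /assoc !nmulE => h.
rewrite /Top /Vop !(barE, nmulE) bu !nmulE.
by apply: subr_eq_trans h _; zmod.
Qed.

Lemma structE x y z w u :
  Vop x y (Vop z w u) - Vop z w (Vop x y u)
  = Vop (Vop x y z) w u - Vop z (Vop y x w) u.
Proof.
exact: (congr1 (fun f : A -> A => f u) (structurable_axiom x y z w)).
Qed.

Lemma Lop_skew r s z : bar r = - r -> bar s = - s ->
  (r ** (s ** z)) *+ 2 = Vop none (s ** r) z - Vop r s z.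
Proof.
move=> hr hs.
have n2 := pchar_neq0 char2 isT; have n3 := pchar_neq0 char3 isT.
have := congr1 (@bar F A) (structE s r none z none).
rewrite /Vop !(bar1, nmul1x, nmulx1) !(barE, nmulE, hr, hs) => e1.
have := congr1 (@bar F A) (structE none r z s none).
rewrite /Vop !(bar1, nmul1x, nmulx1) !(barE, nmulE, hr, hs) => e2.
have := congr1 (@bar F A) (structE none r s (bar z) none).
rewrite /Vop !(bar1, nmul1x, nmulx1) !(barE, nmulE, hr, hs) => e3.
have := structE none r (bar z) none s.
rewrite /Vop !(bar1, nmul1x, nmulx1) !(barE, nmulE, hr, hs) => e4.
have := congr1 (@bar F A) (structE none r none (bar z) s).
rewrite /Vop !(bar1, nmul1x, nmulx1) !(barE, nmulE, hr, hs) => e5.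
have sum6 (a b u1 v1 u2 v2 u3 v3 u4 v4 u5 v5 : A) :
    u1 = v1 -> u2 = v2 -> u3 = v3 -> u4 = v4 -> u5 = v5 ->
    (a - b) *+ 6 = (u1 - v1) *+ 3 + (u2 - v2) *+ 2 + (v3 - u3)
      + (u4 - v4) *+ 2 + (v5 - u5) -> a = b.
  move=> -> -> -> -> ->; rewrite !subrr !mul0rn !addr0.
  rewrite (mulrnA _ 2 3 : _ *+ 6 = _).
  rewrite -!scaler_nat => /eqP.
  by rewrite !scaler_eq0 (negPf n2) (negPf n3) subr_eq0 => /eqP.
by apply: sum6 e1 e2 e3 e4 e5 _; zmod.
Qed.

Lemma TD_gl_bracket f g : TD d f -> TD d g -> TD d (gl_bracket f g).
Proof.
have derT D x : d D -> gl_bracket D (Top x) = Top (D x).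
  move=> dD; have [_ DM Db] := lie_sub d_sub dD.
  apply/funext => z; rewrite glE /Top /Vop !bar1 !nmulx1.
  by rewrite !(derD _ _ dD, derN _ dD, DM, Db, nmulE); zmod.
have TopD x u v : Top x (u + v) = Top x u + Top x v.
  by rewrite /Top /Vop !nmulE; zmod.
move=> [x [D dD ->]] [y [E dE ->]].
have -> : gl_bracket (Top x + D) (Top y + E)
  = gl_bracket (Top x) (Top y) + gl_bracket D (Top y)
    - gl_bracket E (Top x) + gl_bracket D E.
  apply/funext => z; rewrite glE !addfE oppfE !glE (derD _ _ dD) (derD _ _ dE).
  by rewrite !TopD; zmod.
rewrite structurable_axiom !derT //.
apply: TDD; last exact/TDd/(lie_sub_bracket d_sub).
apply: TDD; last exact/TDN/TDT.
apply: TDD; last exact: TDT.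
by apply: TDD; [|apply: TDN]; apply: TD_V.
Qed.

Lemma TD_VL x y r s : r \in skewp A -> s \in skewp A ->
  TD d (Vop x y + (Lop r \o Lop s)).
Proof.
move=> /skewP hr /skewP hs; apply: TDD; first exact: TD_V.
have n2 := pchar_neq0 char2 isT.
suff -> : Lop r \o Lop s = 2%:R^-1 *: (Vop none (s ** r) - Vop r s).
  by apply: TDZ; apply: TDD; [|apply: TDN]; apply: TD_V.
apply/funext => z; rewrite scalefE addfE oppfE -Lop_skew // -scaler_nat.
by rewrite scalerA mulVf // scale1r.
Qed.

End TD.

Section Types.
Variables (F : fieldType) (A : structurableType F).

Record skew := Skew { skew_val :> A; _ : skew_val \in skewp A }.
HB.instance Definition _ := [isSub for skew_val].
HB.instance Definition _ := [Choice of skew by <:].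
HB.instance Definition _ :=
  GRing.SubChoice_isSubLmodule.Build F A (skewp A) skew (@skew_submod F A).

Variable d : set (A -> A).
Hypothesis d_sub : lie_subalgebra (der A) d.

Definition TDp : {pred (A -> A)} := [pred f | `[< TD d f >]].

(* d_sub is a parameter so that the vector space structure on T_A + d can be
   inferred from the type alone *)
Record TDtype (d_sub : lie_subalgebra (der A) d) :=
  MkTD { TD_val :> A -> A; _ : TD_val \in TDp }.
HB.instance Definition _ := [isSub for @TD_val d_sub].
HB.instance Definition _ := [Choice of TDtype d_sub by <:].

Lemma TDp_submod : subsemimod_closed TDp.
Proof.
split=> [|a f /asboolP hf]; last exact/asboolP/(TDZ d_sub).
split=> [|f g /asboolP hf /asboolP hg]; apply/asboolP; first exact: TD0 d_sub.
exact: TDD d_sub _ _ hf hg.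
Qed.
HB.instance Definition _ := GRing.SubChoice_isSubLmodule.Build F (A -> A) TDp
  (TDtype d_sub) TDp_submod.

Definition npart : Type := (A * skew)%type.
HB.instance Definition _ := GRing.Lmodule.on npart.

(* ((u, f), v) stands for u^~ + f + v *)
Definition kantor : Type := (npart * TDtype d_sub * npart)%type.
HB.instance Definition _ := GRing.Lmodule.on kantor.

End Types.

Section Bracket.
Variables (F : fieldType) (A : structurableType F) (d : set (A -> A)).
Hypotheses (char2 : 2%N \notin [pchar F]) (char3 : 3%N \notin [pchar F]).
Hypotheses (d_sub : lie_subalgebra (der A) d) (d_inder : inder A `<=` d).
Local Notation N := (npart A).
Local Notation g := (TDtype d_sub).

Lemma TDtypeP (f : g) : TD d f.
Proof. exact/asboolP/(valP f). Qed.

Definition mkTD (f : A -> A) (hf : TD d f) : g := MkTD d_sub (asboolT hf).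

Definition TD_eps (f : g) : g := mkTD (eps_TD d_sub (TDtypeP f)).

(* [f, (x, s)] = (f x, f^del s) *)
Definition n_act (f : g) (u : N) : N :=
  (f u.1, Skew (del_skew d_sub (TDtypeP f) (valP u.2))).

(* [f, (x, s)^~] = (f^eps x, f^(eps del) s)^~ *)
Definition n_act_tilde (f : g) (u : N) : N := n_act (TD_eps f) u.

Definition n_bracket (u v : N) : N := (0, Skew (psi_skew u.1 v.1)).

(* the three components of [(x, r), (y, s)^~], for u = (x, r), v = (y, s) *)
Definition mix_tilde (u v : N) : N := (- (val v.2 ** u.1), 0).
Definition mix_TD (u v : N) : g :=
  mkTD (TD_VL char2 char3 d_sub d_inder u.1 v.1 (valP u.2) (valP v.2)).
Definition mix_n (u v : N) : N := (val u.2 ** v.1, 0).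

Definition TD_bracket (f h : g) : g :=
  mkTD (TD_gl_bracket char3 d_sub d_inder (TDtypeP f) (TDtypeP h)).

(* the bilinear, antisymmetric extension of the brackets above *)
Definition kantor_bracket (X Y : kantor d_sub) : kantor d_sub :=
  let: (xt, f, x) := X in let: (yt, h, y) := Y in
  (n_act_tilde f yt - n_act_tilde h xt + n_bracket xt yt
     + mix_tilde x yt - mix_tilde y xt,
   TD_bracket f h + mix_TD x yt - mix_TD y xt,
   n_act f y - n_act h x + n_bracket x y + mix_n x yt - mix_n y xt).

End Bracket.

Arguments kantor_bracket {F A d} char2 char3 d_sub d_inder X Y.

Section Automorphisms.
Variables (F : fieldType) (L : lmodType F) (br : L -> L -> L).

Definition is_aut (f : L -> L) : Prop :=
  [/\ linear f, bijective f & forall x y, f (br x y) = br (f x) (f y)].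

Definition autp : {pred (L -> L)} := [pred f | `[< is_aut f >]].

Record LieAut := MkLieAut { aut_val :> L -> L; _ : aut_val \in autp }.
HB.instance Definition _ := [isSub for aut_val].
HB.instance Definition _ := [Choice of LieAut by <:].

Lemma is_aut_id : is_aut id.
Proof. by split=> //; exists id. Qed.

Lemma is_aut_comp f g : is_aut f -> is_aut g -> is_aut (f \o g).
Proof.
move=> [fl fb fm] [gl gb gm]; split; last by move=> x y /=; rewrite gm fm.
- by move=> a x y /=; rewrite gl fl.
- exact: bij_comp.
Qed.

Lemma is_aut_inv f g : is_aut f -> cancel f g -> cancel g f -> is_aut g.
Proof.
move=> [fl _ fm] fK gK; split.
- by move=> a x y; apply: (can_inj fK); rewrite gK fl !gK.
- by exists f.
- by move=> x y; apply: (can_inj fK); rewrite gK fm !gK.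
Qed.

Lemma LieAutP (f : LieAut) : is_aut f.
Proof. exact/asboolP/(valP f). Qed.

Definition mkLieAut f (hf : is_aut f) : LieAut := MkLieAut (asboolT hf).

Definition aut_one : LieAut := mkLieAut is_aut_id.
Definition aut_mul (f g : LieAut) : LieAut :=
  mkLieAut (is_aut_comp (LieAutP f) (LieAutP g)).

Lemma aut_inv_subproof (f : LieAut) :
  {g : LieAut | cancel f g /\ cancel g f}.
Proof.
have [_ fb _] := LieAutP f; apply: cid; case: fb => g fK gK.
by exists (mkLieAut (is_aut_inv (LieAutP f) fK gK)).
Qed.
Definition aut_inv (f : LieAut) : LieAut := sval (aut_inv_subproof f).

Lemma aut_mulA : associative aut_mul.
Proof. by move=> f g h; apply: val_inj. Qed.
Lemma aut_mul1 : left_id aut_one aut_mul.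
Proof. by move=> f; apply: val_inj. Qed.
Lemma aut_mulr1 : right_id aut_one aut_mul.
Proof. by move=> f; apply: val_inj. Qed.
Lemma aut_mulV : left_inverse aut_one aut_inv aut_mul.
Proof.
move=> f; apply: val_inj; apply/funext => x /=.
by case: (svalP (aut_inv_subproof f)) => fK _; exact: fK.
Qed.
Lemma aut_mulrV : right_inverse aut_one aut_inv aut_mul.
Proof.
move=> f; apply: val_inj; apply/funext => x /=.
by case: (svalP (aut_inv_subproof f)) => _ gK; exact: gK.
Qed.

HB.instance Definition _ := isGroup.Build LieAut aut_mulA aut_mul1 aut_mulr1
  aut_mulV aut_mulrV.

End Automorphisms.

(* Main.v *)
(** With [J] the antidiagonal 3 x 3 matrix, send
    [(y,s)~ + (T_a + D) + (x,r)] to the pair formed by the derivation [D] and the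
    trace zero matrix
<<
          a      x         -r
      X = bar y  bar a - a -bar x
          -s     -y        -bar a
>>
    over [A], which is skew-hermitian for [J]. The Lie bracket becomes
    [[X,Y] = XY - YX - 1/3 tr(XY - YX) + D(Y) - E(X)] together with the
    derivation [[D,E] + 1/2 sum_(i,j) D_(x_ij,y_ji)] (this uses [D_(h,s) = 0] for [h]
    hermitian and [s] skew). Both are visibly invariant under conjugation by
    scalar matrices, so the orthogonal group of the form [J] over [F] acts by
    automorphisms. Since [-1] is a square, this form is a sum of three squares
    and its orthogonal group contains the 3-dimensional representation of [S_4] on
    the orthogonal of [(1,1,1,1)] in [F^4]. *)

Require Import Defs.
From HB Require Import structures.
From mathcomp Require Import all_boot all_fingroup all_algebra.
From mathcomp Require Import all_classical.
From mathcomp Require Import ring.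
Set Implicit Arguments.
Unset Strict Implicit.
Unset Printing Implicit Defensive.
Import GRing.Theory ZmodTactic.
Local Open Scope classical_set_scope.
Local Open Scope ring_scope.

(** * Derivations of a structurable algebra *)

Section InvAlgebra.
Variables (F : fieldType) (A : invAlgebraType F).
Implicit Types (x y z : A).

Lemma Top1 x : Top x none = x *+ 2 - bar x.
Proof. by rewrite /Top /Vop !(barE, nmulE); zmod. Qed.

Lemma TopE x z : Top x z = x ** z + z ** (x - bar x).
Proof. by rewrite /Top /Vop !(barE, nmulE); zmod. Qed.

Lemma Dop_linearl y a x x' : Dop (a *: x + x') y = a *: Dop x y + Dop x' y.
Proof.
apply/funext => z; rewrite !(addfE, scalefE) /Dop /ncomm /assoc.
rewrite !(barD, barZ) !(nmulDl, nmulDr, nmulZl, nmulZr) !nmulNl !nmulNr.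
rewrite !(nmulDl, nmulDr, nmulZl, nmulZr).
rewrite !(scalerDr, scalerN, scalerA, opprD) ![_ * a]mulrC.
by zmod.
Qed.

Lemma Dop_linearr x a y y' : Dop x (a *: y + y') = a *: Dop x y + Dop x y'.
Proof.
apply/funext => z; rewrite !(addfE, scalefE) /Dop /ncomm /assoc.
rewrite !(barD, barZ) !(nmulDl, nmulDr, nmulZl, nmulZr) !nmulNl !nmulNr.
rewrite !(nmulDl, nmulDr, nmulZl, nmulZr).
rewrite !(scalerDr, scalerN, scalerA, opprD) ![_ * a]mulrC.
by zmod.
Qed.

Definition Dopr y x : A -> A := Dop x y.

HB.instance Definition _ y := GRing.isLinear.Build F A (A -> A) *:%R
  (Dopr y) (Dop_linearl y).
HB.instance Definition _ x := GRing.isLinear.Build F A (A -> A) *:%R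
  (@Dop F A x) (Dop_linearr x).

Lemma zerofE x : (0 : A -> A) x = 0. Proof. by []. Qed.

Lemma Dop1l x : Dop none x = 0.
Proof.
apply/funext => z; rewrite /Dop bar1.
have -> : ncomm none x + ncomm none (bar x) = 0.
  by rewrite /ncomm !nmulE; zmod.
by rewrite /ncomm /assoc !nmulE subrr scaler0 zerofE; zmod.
Qed.
End InvAlgebra.

Section Structurable.
Variables (F : fieldType) (A : structurableType F).
Hypotheses (char2 : 2%N \notin [pchar F]) (char3 : 3%N \notin [pchar F]).
Implicit Types (x y z r s h k : A).

Lemma mul2_inj (V : lmodType F) (x y : V) : x *+ 2 = y *+ 2 -> x = y.
Proof.
have n2 := pchar_neq0 char2 isT.
by rewrite -!scaler_nat => /(scalerI n2).
Qed.

Lemma third3 (V : lmodType F) (x : V) : (3%:R^-1 *: x) *+ 3 = x.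
Proof. by rewrite -scaler_nat scalerA mulfV ?scale1r // pchar_neq0. Qed.

Lemma half2 (V : lmodType F) (x : V) : (2%:R^-1 *: x) *+ 2 = x.
Proof. by rewrite -scaler_nat scalerA mulfV ?scale1r // pchar_neq0. Qed.

(** A case of skew-alternativity: exchanging a skew element with its neighbour in an associator
    costs a sign. Two instances of the structurable identity add up to twice this relation. *)
Lemma assoc_herm_skew h s z : bar h = h -> bar s = - s ->
  assoc z h s = - assoc z s h.
Proof.
move=> hh hs; apply: mul2_inj.
have := structE h none s none z.
rewrite /Vop !(bar1, nmul1x, nmulx1) !(barE, nmulE, hh, hs) => e1.
have := structE h none none s z.
rewrite /Vop !(bar1, nmul1x, nmulx1) !(barE, nmulE, hh, hs) => e2.
rewrite /assoc.
apply: subr_eq_trans (congr2 +%R e1 e2) _.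
by zmod.
Qed.

(** The two commutators cancel, since the involution changes the sign of [s] only. What remains is
    (z,s,h) + (z,h,s), which vanishes by skew-alternativity. *)
Lemma Dop_herm_skew h s : bar h = h -> bar s = - s -> Dop h s = 0.
Proof.
move=> hh hs; apply/funext => z; rewrite /Dop hh hs.
have -> : ncomm h s + ncomm h (- s) = 0 by rewrite /ncomm !nmulE; zmod.
have -> : assoc z h (- s) = - assoc z h s by rewrite /assoc !nmulE; zmod.
rewrite (assoc_herm_skew z hh hs) /ncomm nmul0x nmulx0 subrr scaler0 zerofE.
by zmod.
Qed.

Lemma Dop_skew_herm h s : bar h = h -> bar s = - s -> Dop s h = 0.
Proof.
move=> hh hs; apply/funext => z; rewrite /Dop hh hs.
have -> : ncomm s h + ncomm (- s) h = 0 by rewrite /ncomm !nmulE; zmod.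
have -> : assoc z (- s) h = - assoc z s h by rewrite /assoc !nmulE; zmod.
rewrite (assoc_herm_skew z hh hs) /ncomm nmul0x nmulx0 subrr scaler0 zerofE.
by zmod.
Qed.

Definition hpart x := 2%:R^-1 *: (x + bar x).
Definition spart x := 2%:R^-1 *: (x - bar x).

Lemma bar_hpart x : bar (hpart x) = hpart x.
Proof. by rewrite /hpart barZ barD barK addrC. Qed.

Lemma bar_spart x : bar (spart x) = - spart x.
Proof. by rewrite /spart barZ barD barN barK -scalerN opprB addrC. Qed.

Lemma hspartE x : x = hpart x + spart x.
Proof.
rewrite /hpart /spart -scalerDr addrACA subrr addr0 -mulr2n -scaler_nat.
by rewrite scalerA mulVf ?scale1r // pchar_neq0.
Qed.

Lemma hspart_bar x : bar x = hpart x - spart x.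
Proof. by rewrite {1}[x]hspartE barD bar_hpart bar_spart. Qed.

Lemma DopDr x y y' : Dop x (y + y') = Dop x y + Dop x y'.
Proof. exact: (raddfD (Dop x)). Qed.
Lemma DopNr x y : Dop x (- y) = - Dop x y.
Proof. exact: (raddfN (Dop x)). Qed.
Lemma DopDl y x x' : Dop (x + x') y = Dop x y + Dop x' y.
Proof. exact: (raddfD (Dopr y)). Qed.
Lemma DopNl y x : Dop (- x) y = - Dop x y.
Proof. exact: (raddfN (Dopr y)). Qed.

Lemma Dop_hs x y : Dop x y = Dop (hpart x) (hpart y) + Dop (spart x) (spart y).
Proof.
rewrite {1}[x]hspartE {1}[y]hspartE !(DopDl, DopDr).
rewrite (Dop_herm_skew (bar_hpart _) (bar_spart _)).
by rewrite (Dop_skew_herm (bar_hpart _) (bar_spart _)) addr0 add0r.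
Qed.

(** Only pairs of equal symmetry contribute to D, and on these the signs coming from the involution
    cancel. *)
Lemma Dop_bar x y : Dop (bar x) (bar y) = Dop x y.
Proof.
rewrite [RHS]Dop_hs !hspart_bar !(DopDl, DopDr, DopNl, DopNr).
rewrite (Dop_herm_skew (bar_hpart _) (bar_spart _)).
rewrite (Dop_skew_herm (bar_hpart _) (bar_spart _)).
by zmod.
Qed.

(** On two hermitian or two skew elements the definition reads 1/3 [2[x,y],z] + (z,y,x) - (z,x,y),
    which is antisymmetric in x and y; mixed pairs contribute nothing. *)
Lemma DopC x y : Dop y x = - Dop x y.
Proof.
apply/eqP; rewrite -addr_eq0; apply/eqP/funext => z.
rewrite [Dop x y]Dop_hs [Dop y x]Dop_hs !addfE /Dop.
rewrite !bar_hpart !bar_spart /assoc /ncomm.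
rewrite !(nmulE, scalerDr, scalerN, scalerMnr) zerofE.
by zmod.
Qed.

Lemma Dop1r x : Dop x none = 0.
Proof. by rewrite DopC Dop1l oppr0. Qed.

(** Names both components of V_{x,y} in T_A + d. As [u] is skew, T_{-u} z = -uz - 2zu; together with
    the term [u,z] of the derivation this leaves -3zu, where no division by 3 survives. *)
Lemma Vop_TopD x y :
  let u := 3%:R^-1 *: (ncomm x (bar y) + ncomm (bar x) y) in
  Vop x y = Top (x ** bar y - u) + Dop x (bar y).
Proof.
move=> u.
have u3 : u *+ 3 = ncomm x (bar y) + ncomm (bar x) y by apply: third3.
have bu : bar u = - u.
  by rewrite /u barZ /ncomm -scalerN !barE; congr (_ *: _); zmod.
apply/funext => z; rewrite addfE /Dop barK /ncomm.
rewrite scalerBr -nmulZl -nmulZr -/(ncomm _ _) -/(ncomm _ _) -/u.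
have := congr1 (fun t => z ** t) u3; rewrite /ncomm /assoc !nmulE => h.
rewrite /Top /Vop !(barE, nmulE) bu !nmulE.
by apply: subr_eq_trans h _; zmod.
Qed.
End Structurable.

(** * Matrices over a vector space *)

Section Entrywise.
Variables (F : fieldType) (n : nat).
Implicit Types (M N : 'M[F]_n) (V W : lmodType F).

(** Matrices over a vector space are functions of two indices, so they inherit its linear structure;
    scalar matrices act on them from both sides. *)
Definition lmul V M (X : 'I_n -> 'I_n -> V) : 'I_n -> 'I_n -> V :=
  fun i j => \sum_k M i k *: X k j.
Definition rmul V (X : 'I_n -> 'I_n -> V) M : 'I_n -> 'I_n -> V :=
  fun i j => \sum_k M k j *: X i k.
Definition conjm V M N (X : 'I_n -> 'I_n -> V) := lmul M (rmul X N).
Definition mtr V (X : 'I_n -> 'I_n -> V) : V := \sum_i X i i.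
Definition mscal V (t : V) : 'I_n -> 'I_n -> V :=
  fun i j => if i == j then t else 0.
Definition mmap V W (f : V -> W) (X : 'I_n -> 'I_n -> V) : 'I_n -> 'I_n -> W :=
  fun i j => f (X i j).

Lemma mx_ext V (X Y : 'I_n -> 'I_n -> V) :
  (forall i j, X i j = Y i j) -> X = Y.
Proof. by move=> XY; apply/funext => i; apply/funext => j. Qed.

Lemma lmulA V M N (X : 'I_n -> 'I_n -> V) :
  lmul (M *m N) X = lmul M (lmul N X).
Proof.
apply: mx_ext => i j; rewrite /lmul.
under eq_bigr => k _ do rewrite mxE scaler_suml.
rewrite exchange_big; apply: eq_bigr => l _ /=.
by rewrite scaler_sumr; apply: eq_bigr => k _; rewrite scalerA.
Qed.

Lemma rmulA V M N (X : 'I_n -> 'I_n -> V) :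
  rmul X (M *m N) = rmul (rmul X M) N.
Proof.
apply: mx_ext => i j; rewrite /rmul.
under eq_bigr => k _ do rewrite mxE scaler_suml.
rewrite exchange_big; apply: eq_bigr => l _ /=.
by rewrite scaler_sumr; apply: eq_bigr => k _; rewrite scalerA mulrC.
Qed.

Lemma lmul_rmul V M N (X : 'I_n -> 'I_n -> V) :
  lmul M (rmul X N) = rmul (lmul M X) N.
Proof.
apply: mx_ext => i j; rewrite /lmul /rmul.
under eq_bigr => k _ do rewrite scaler_sumr.
rewrite exchange_big; apply: eq_bigr => l _ /=.
by rewrite scaler_sumr; apply: eq_bigr => k _; rewrite !scalerA mulrC.
Qed.

Lemma lmul1 V (X : 'I_n -> 'I_n -> V) : lmul 1%:M X = X.
Proof.
apply: mx_ext => i j; rewrite /lmul (bigD1 i) //= mxE eqxx scale1r.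
rewrite big1 ?addr0 //.
by move=> k /negPf ki; rewrite mxE eq_sym ki scale0r.
Qed.

Lemma rmul1 V (X : 'I_n -> 'I_n -> V) : rmul X 1%:M = X.
Proof.
apply: mx_ext => i j; rewrite /rmul (bigD1 j) //= mxE eqxx scale1r.
rewrite big1 ?addr0 //.
by move=> k /negPf ki; rewrite mxE ki scale0r.
Qed.

Lemma conjmM V M N M' N' (X : 'I_n -> 'I_n -> V) :
  conjm (M *m M') (N' *m N) X = conjm M N (conjm M' N' X).
Proof. by rewrite /conjm lmulA rmulA -lmul_rmul. Qed.

Lemma conjm1 V (X : 'I_n -> 'I_n -> V) : conjm 1%:M 1%:M X = X.
Proof. by rewrite /conjm rmul1 lmul1. Qed.

Lemma conjm_linear V M N : linear (@conjm V M N).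
Proof.
move=> a X Y; apply: mx_ext => i j.
transitivity (a *: conjm M N X i j + conjm M N Y i j) => //.
rewrite /conjm /lmul /rmul scaler_sumr -big_split /=; apply: eq_bigr => k _.
rewrite scalerA mulrC -scalerA -scalerDr; congr (_ *: _).
rewrite scaler_sumr -big_split /=; apply: eq_bigr => l _.
by rewrite scalerA mulrC -scalerA -scalerDr.
Qed.

HB.instance Definition _ V M N := GRing.isLinear.Build F
  ('I_n -> 'I_n -> V) ('I_n -> 'I_n -> V) *:%R (conjm M N)
  (@conjm_linear V M N).

Lemma conjm_map V W M N (f : {linear V -> W}) X :
  conjm M N (mmap f X) = mmap f (conjm M N X).
Proof.
apply: mx_ext => i j; rewrite /conjm /lmul /rmul /mmap linear_sum.
apply: eq_bigr => k _; rewrite [RHS]linearZZ; congr (_ *: _).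
by rewrite [RHS]linear_sum; apply: eq_bigr => l _; rewrite linearZZ.
Qed.

Lemma conjm_scal V M N (t : V) : M *m N = 1%:M ->
  conjm M N (mscal t) = mscal t.
Proof.
move=> MN; rewrite -[RHS]lmul1 -MN lmulA /conjm; congr lmul.
apply: mx_ext => i j; rewrite /rmul /lmul /mscal.
rewrite (bigD1 i) //= eqxx big1 ?addr0; last first.
  by move=> k /negPf ki; rewrite eq_sym ki scaler0.
rewrite (bigD1 j) //= eqxx big1 ?addr0 //.
by move=> k /negPf ki; rewrite ki scaler0.
Qed.

Lemma mtr_lmul V M (X : 'I_n -> 'I_n -> V) : mtr (lmul M X) = mtr (rmul X M).
Proof. by rewrite /mtr /lmul /rmul exchange_big. Qed.

Lemma mtr_conjm V M N (X : 'I_n -> 'I_n -> V) : N *m M = 1%:M ->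
  mtr (conjm M N X) = mtr X.
Proof. by move=> NM; rewrite mtr_lmul -rmulA NM rmul1. Qed.

Section Product.
Variables (V W : lmodType F) (b : V -> V -> W).
Hypotheses (bl : forall y, linear (b^~ y)) (br : forall x, linear (b x)).
Implicit Types X Y : 'I_n -> 'I_n -> V.

(** The bilinear map [b] is arbitrary because two are needed: the product of A, and [Dop], with
    values in the endomorphisms. *)
Definition mprod X Y : 'I_n -> 'I_n -> W :=
  fun i j => \sum_k b (X i k) (Y k j).

Let bsuml (c : 'I_n -> F) (u : 'I_n -> V) y :
  b (\sum_k c k *: u k) y = \sum_k c k *: b (u k) y.
Proof.
pose B := GRing.isLinear.Build F V W *:%R (b^~ y) (bl y).
pose f : {linear V -> W} := HB.pack (b^~ y) B.
rewrite -[LHS]/(f _) linear_sum; apply: eq_bigr => k _.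
by rewrite linearZZ.
Qed.

Let bsumr (c : 'I_n -> F) (u : 'I_n -> V) x :
  b x (\sum_k c k *: u k) = \sum_k c k *: b x (u k).
Proof.
pose B := GRing.isLinear.Build F V W *:%R (b x) (br x).
pose f : {linear V -> W} := HB.pack (b x) B.
rewrite -[LHS]/(f _) linear_sum; apply: eq_bigr => k _.
by rewrite linearZZ.
Qed.

Lemma mprod_lmul M X Y : mprod (lmul M X) Y = lmul M (mprod X Y).
Proof.
apply: mx_ext => i j; rewrite /mprod /lmul.
under eq_bigr => k _ do rewrite bsuml.
rewrite exchange_big; apply: eq_bigr => l _ /=.
by rewrite scaler_sumr.
Qed.

Lemma mprod_rmul M X Y : mprod X (rmul Y M) = rmul (mprod X Y) M.
Proof.
apply: mx_ext => i j; rewrite /mprod /rmul.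
under eq_bigr => k _ do rewrite bsumr.
rewrite exchange_big; apply: eq_bigr => l _ /=.
by rewrite scaler_sumr.
Qed.

Lemma mprod_mid M X Y : mprod (rmul X M) Y = mprod X (lmul M Y).
Proof.
apply: mx_ext => i j; rewrite /mprod /rmul /lmul.
under eq_bigr => k _ do rewrite bsuml.
rewrite exchange_big; apply: eq_bigr => l _ /=.
by rewrite bsumr.
Qed.

Lemma mprod_conjm M N X Y : N *m M = 1%:M ->
  mprod (conjm M N X) (conjm M N Y) = conjm M N (mprod X Y).
Proof.
move=> NM; rewrite {1}/conjm mprod_lmul mprod_mid -lmulA NM lmul1.
by rewrite mprod_rmul.
Qed.
End Product.
End Entrywise.

(** * Skew-hermitian matrices of the antidiagonal form *)

Definition i0 : 'I_3 := @Ordinal 3 0 isT.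
Definition i1 : 'I_3 := @Ordinal 3 1 isT.
Definition i2 : 'I_3 := @Ordinal 3 2 isT.

Lemma ord3P (P : 'I_3 -> Prop) : P i0 -> P i1 -> P i2 -> forall i, P i.
Proof.
by move=> p0 p1 p2 [[|[|[|//]]] p]; rewrite (bool_irrelevance p isT).
Qed.

Lemma sum3 (V : nmodType) (G : 'I_3 -> V) :
  \sum_k G k = G i0 + G i1 + G i2.
Proof.
rewrite !big_ord_recl big_ord0 addr0 addrA.
by congr (G _ + G _ + G _); apply: val_inj.
Qed.

Lemma rev3 : (rev_ord i0 = i2) * (rev_ord i1 = i1) * (rev_ord i2 = i0).
Proof. by do !split; apply: val_inj. Qed.

Section SkewMatrices.
Variables (F : fieldType) (A : invAlgebraType F).
Implicit Types (X Y : 'I_3 -> 'I_3 -> A) (f g : A -> A).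

(* [J X] is skew-hermitian, and [X] has trace zero. *)
Definition jskew X :=
  (forall i j, X (rev_ord j) (rev_ord i) = - bar (X i j)) /\ mtr X = 0.

(** Reflection in the antidiagonal recovers the entries (2,2), (1,2) and (1,0); the vanishing trace
    then gives the central one. *)
Lemma jskew_eq X Y : jskew X -> jskew Y ->
  X i0 i0 = Y i0 i0 -> X i0 i1 = Y i0 i1 -> X i0 i2 = Y i0 i2 ->
  X i2 i0 = Y i2 i0 -> X i2 i1 = Y i2 i1 -> X = Y.
Proof.
move=> [sX tX] [sY tY] e00 e01 e02 e20 e21.
have e22 : X i2 i2 = Y i2 i2 by rewrite -rev3 sX sY e00.
have e11 : X i1 i1 = Y i1 i1.
  move: tX; rewrite -tY /mtr !sum3 e00 e22 => /addIr.
  by move=> /addrI.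
have e12 : X i1 i2 = Y i1 i2.
  by have := sX i0 i1; have := sY i0 i1; rewrite !rev3 => -> ->; rewrite e01.
have e10 : X i1 i0 = Y i1 i0.
  by have := sX i2 i1; have := sY i2 i1; rewrite !rev3 => -> ->; rewrite e21.
by apply: mx_ext; apply: ord3P; apply: ord3P.
Qed.

Lemma jskewD X Y : jskew X -> jskew Y -> jskew (X + Y).
Proof.
move=> [sX tX] [sY tY]; split.
  by move=> i j; rewrite ![(X + Y) _ _]/(X _ _ + Y _ _) sX sY barD opprD.
by rewrite /mtr big_split /= -!/(mtr _) tX tY addr0.
Qed.

Lemma jskewN X : jskew X -> jskew (- X).
Proof.
move=> [sX tX]; split.
  by move=> i j; rewrite ![(- X) _ _]/(- X _ _) sX barN.
by rewrite /mtr sumrN -/(mtr _) tX oppr0.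
Qed.

Lemma jskew_map f X : linear f ->
  (forall x, f (bar x) = bar (f x)) -> jskew X -> jskew (mmap f X).
Proof.
move=> fl fb [sX tX].
pose B := GRing.isLinear.Build F A A *:%R f fl.
pose h : {linear A -> A} := HB.pack f B.
split; first by move=> i j; rewrite /mmap sX -fb [LHS](raddfN h).
by rewrite /mtr /mmap -(raddf_sum h) -/(mtr X) tX [LHS](raddf0 h).
Qed.

Definition mcomm X Y := mprod nmul X Y - mprod nmul Y X.
Definition traceless X := X - mscal (3%:R^-1 *: mtr X).
Definition mbr X f Y g := traceless (mcomm X Y) + mmap f Y - mmap g X.

Lemma mtr_mscal (t : A) : mtr (@mscal F 3 A t) = t *+ 3.
Proof. by rewrite /mtr sum3 /mscal !eqxx; zmod. Qed.

Lemma jskew_mcomm X Y : jskew X -> jskew Y ->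
  forall i j, mcomm X Y (rev_ord j) (rev_ord i) = - bar (mcomm X Y i j).
Proof.
move=> [sX _] [sY _] i j.
have E (U V : 'I_3 -> 'I_3 -> A) k l : (U - V) k l = U k l - V k l by [].
rewrite /mcomm !E barD barN opprB /mprod !(raddf_sum (@bar F A)); congr (_ - _).
  rewrite (reindex_inj rev_ord_inj); apply: eq_bigr => k _ /=.
  by rewrite sX sY !nmulE barM opprK.
rewrite (reindex_inj rev_ord_inj); apply: eq_bigr => k _ /=.
by rewrite sX sY !nmulE barM opprK.
Qed.

(** Reflection permutes the diagonal, so the trace is a skew element and the scalar matrix
    subtracted is itself skew for J. *)
Lemma jskew_traceless (char3 : 3%N \notin [pchar F]) X :
  (forall i j, X (rev_ord j) (rev_ord i) = - bar (X i j)) ->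
  jskew (traceless X).
Proof.
move=> sX; split; last first.
  have -> : mtr (traceless X) = mtr X - mtr (@mscal F 3 A (3%:R^-1 *: mtr X)).
    by rewrite /mtr sumrB.
  by rewrite mtr_mscal third3 // subrr.
have tX : bar (3%:R^-1 *: mtr X) = - (3%:R^-1 *: mtr X).
  rewrite barZ -scalerN; congr (_ *: _).
  rewrite /mtr (raddf_sum (@bar F A)) -sumrN.
  rewrite [RHS](reindex_inj rev_ord_inj); apply: eq_bigr => k _ /=.
  by rewrite sX opprK.
have E (U V : 'I_3 -> 'I_3 -> A) k l : (U - V) k l = U k l - V k l by [].
move=> i j; rewrite /traceless !E sX barD barN opprD; congr (_ - _).
rewrite /mscal (inj_eq rev_ord_inj) eq_sym; case: eqP => _.
  by rewrite tX opprK.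
by rewrite raddf0 oppr0.
Qed.

Lemma jskew_conjm (M N : 'M[F]_3) X : N *m M = 1%:M ->
  (forall i j, N (rev_ord j) (rev_ord i) = M i j) ->
  jskew X -> jskew (conjm M N X).
Proof.
move=> NM sMN [sX tX]; split; last by rewrite mtr_conjm.
have E i j : conjm M N X i j = \sum_k \sum_l (M i k * N l j) *: X k l.
  rewrite /conjm /lmul /rmul; apply: eq_bigr => k _; rewrite scaler_sumr.
  by apply: eq_bigr => l _; rewrite scalerA.
move=> i j; rewrite !E (raddf_sum (@bar F A)) -sumrN.
rewrite (reindex_inj rev_ord_inj) /= exchange_big /=.
rewrite (reindex_inj rev_ord_inj); apply: eq_bigr => k _ /=.
rewrite (raddf_sum (@bar F A)) -sumrN; apply: eq_bigr => l _ /=.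
by rewrite barZ -scalerN -sX -!sMN !rev_ordK mulrC.
Qed.
End SkewMatrices.

(** * Kantor's construction by matrices *)

Section Projections.
Variables (F : fieldType) (A : structurableType F).
Hypotheses (char2 : 2%N \notin [pchar F]) (char3 : 3%N \notin [pchar F]).
Implicit Types (x y z a b r s : A) (f g D E : A -> A).

(* The solution [x] of [2 x - bar x = f 1], since [T_x 1 = 2 x - bar x]. *)
Definition topart f : A := 3%:R^-1 *: (f none *+ 2 + bar (f none)).
Definition dpart f : A -> A := f - Top (topart f).

Lemma topart_linear : linear topart.
Proof.
move=> c f g; rewrite /topart !(addfE, scalefE) barD barZ mulrnDl scalerMnr.
by rewrite addrACA -[c *: _ + _]scalerDr [LHS]scalerDr !scalerA mulrC.
Qed.

Lemma dpart_linear : linear dpart.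
Proof.
move=> c f g; rewrite /dpart topart_linear Top_linear [c *: (f - _)]scalerBr.
by zmod.
Qed.

HB.instance Definition _ := GRing.isLinear.Build F (A -> A) A *:%R
  topart topart_linear.
HB.instance Definition _ := GRing.isLinear.Build F (A -> A) (A -> A) *:%R
  dpart dpart_linear.

Lemma topart_Top x : topart (Top x) = x.
Proof.
rewrite /topart Top1 !barE (_ : _ + _ = x *+ 3); last by zmod.
by rewrite -scaler_nat scalerA mulVf ?scale1r // pchar_neq0.
Qed.

Lemma topart_eq0 f : f none = 0 -> topart f = 0.
Proof. by rewrite /topart => ->; rewrite raddf0 mul0rn addr0 scaler0. Qed.

Lemma dpart_Top x : dpart (Top x) = 0.
Proof. by rewrite /dpart topart_Top subrr. Qed.

Lemma dpart_id f : f none = 0 -> dpart f = f.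
Proof. by move=> f1; rewrite /dpart topart_eq0 // Top0 subr0. Qed.

Lemma dpartE f z : f z = topart f ** z + z ** (topart f - bar (topart f))
  + dpart f z.
Proof. by rewrite -TopE /dpart addfE oppfE addrCA subrr addr0. Qed.

Lemma topart_eq f c : f none = c *+ 2 - bar c -> topart f = c.
Proof. by rewrite -Top1 => f1; rewrite -[RHS]topart_Top /topart f1. Qed.

Lemma Dop_one x y : Dop x y none = 0.
Proof.
rewrite /Dop /ncomm /assoc !(nmul1x, nmulx1) !subrr scaler0.
by zmod.
Qed.

Lemma dpart_Vop x y : dpart (Vop x y) = Dop x (bar y).
Proof.
rewrite (Vop_TopD char3) raddfD /= dpart_Top add0r dpart_id //.
exact: Dop_one.
Qed.

(** Twice L_r L_s is V_{1,sr} - V_{r,s}, and the first term contributes an inner derivation D_{1,.}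
    = 0. *)
Lemma dpart_LL r s : bar r = - r -> bar s = - s ->
  dpart (Lop r \o Lop s) *+ 2 = Dop r s.
Proof.
move=> hr hs; rewrite -raddfMn.
have -> : (Lop r \o Lop s) *+ 2 = Vop none (s ** r) - Vop r s.
  apply/funext => z; rewrite addfE oppfE -(Lop_skew char2 char3) //.
rewrite raddfB /= !dpart_Vop Dop1l hs DopNr.
by rewrite sub0r opprK.
Qed.

(** The structurable identity gives [T_a,T_b] = V_{T_a b,1} - V_{b,c} with c = V_{1,a} 1. The first
    term lies in T_A, and the conjugate of c is 2a - [bar a]. *)
Lemma dpart_Top_Top a b :
  dpart (gl_bracket (Top a) (Top b)) = Dop a b *+ 2 - Dop (bar a) b.
Proof.
rewrite structurable_axiom raddfB /= !dpart_Vop.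
rewrite bar1 (Dop1r char2) sub0r -(DopC char2).
have -> : bar (Vop none a none) = a *+ 2 - bar a.
  by rewrite /Vop !(barE, nmulE); zmod.
by rewrite DopDl DopNl !mulr2n DopDl.
Qed.
End Projections.

Section Kantor.
Variables (F : fieldType) (A : structurableType F) (d : set (A -> A)).
Hypotheses (char2 : 2%N \notin [pchar F]) (char3 : 3%N \notin [pchar F]).
Hypotheses (d_sub : lie_subalgebra (der A) d) (d_inder : inder A `<=` d).
Local Notation K := (kantor d_sub).
Implicit Types (X Y : K) (f : A -> A) (Z : 'I_3 -> 'I_3 -> A).

Definition kder X : A -> A := dpart (TD_val X.1.2).

Definition kmx X : 'I_3 -> 'I_3 -> A :=
  let: (xt, h, x) := X in let a := topart h in fun i j =>
  match val i, val j with
  | 0, 0 => a | 0, 1 => x.1 | 0, _ => - val x.2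
  | 1, 0 => bar xt.1 | 1, 1 => bar a - a | 1, _ => - bar x.1
  | _, 0 => - val xt.2 | _, 1 => - xt.1 | _, _ => - bar a
  end.

Lemma kder_d X : d (kder X).
Proof.
have [x [D dD fE]] := TDtypeP X.1.2; rewrite /kder fE raddfD /=.
by rewrite (dpart_Top char3) add0r dpart_id // (der1 d_sub dD).
Qed.

Lemma kmx_jskew X : jskew (kmx X).
Proof.
case: X => [[[y s] h] [x r]]; split; last by rewrite /mtr sum3 /=; zmod.
have hs := skewP _ (valP s); have hr := skewP _ (valP r).
by apply: ord3P; apply: ord3P; rewrite !rev3 /= ?(barE, hs, hr) //; zmod.
Qed.

Lemma spart_skew (x : A) : spart x \in skewp A.
Proof. exact/skewP/bar_spart. Qed.

Definition skew_of (x : A) : Defs.skew A := Skew (spart_skew x).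

Lemma skew_ofK x : bar x = - x -> val (skew_of x) = x.
Proof.
move=> hx; rewrite /= /spart hx opprK -mulr2n -scaler_nat scalerA.
by rewrite mulVf ?scale1r // (pchar_neq0 char2 isT).
Qed.

Lemma TD_TopD x f : d f -> TD d (Top x + f).
Proof. by move=> df; exists x; exists f. Qed.

(** Inverse of the pair [kmx], [kder]. Projecting the corner entries to their skew parts makes it
    defined for every [Z]; on [jskew] matrices the projection changes nothing. *)
Definition rebuild Z f (df : d f) : K :=
  ((- Z i2 i1, skew_of (- Z i2 i0)), mkTD d_sub (TD_TopD (Z i0 i0) df),
   (Z i0 i1, skew_of (- Z i0 i2))).

Lemma kder_rebuild Z f (df : d f) : kder (rebuild Z df) = f.
Proof.
rewrite /kder /rebuild /= raddfD /= (dpart_Top char3) add0r dpart_id //.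
exact: (der1 d_sub df).
Qed.

Lemma kmx_rebuild Z f (df : d f) : jskew Z -> kmx (rebuild Z df) = Z.
Proof.
move=> sZ; apply: (jskew_eq (kmx_jskew _) sZ) => //=.
- rewrite raddfD /= (topart_Top char3) topart_eq0 ?addr0 //.
  exact: (der1 d_sub df).
- case: sZ => /(_ i0 i2) + _; rewrite !rev3 => e.
  by rewrite [spart _]skew_ofK ?opprK // barN -e.
- case: sZ => /(_ i2 i0) + _; rewrite !rev3 => e.
  by rewrite [spart _]skew_ofK ?opprK // barN -e.
- by rewrite opprK.
Qed.

Lemma kantor_eq X Y : kmx X = kmx Y -> kder X = kder Y -> X = Y.
Proof.
case: X => [[[y s] h] [x r]]; case: Y => [[[y' s'] h'] [x' r']] e.
have ee i j := congr1 (fun Z : 'I_3 -> 'I_3 -> A => Z i j) e.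
have := ee i0 i0; have := ee i0 i1; have := ee i0 i2; have := ee i2 i0.
have := ee i2 i1; rewrite /kder /= => /oppr_inj -> /oppr_inj e1 /oppr_inj e2.
move=> -> e3 e4; rewrite (val_inj e1) (val_inj e2); congr (_, _, _).
by apply: val_inj; apply/funext => z /=; rewrite [LHS]dpartE [RHS]dpartE e3 e4.
Qed.

Lemma kmx_linear : linear kmx.
Proof.
move=> c X Y; apply: mx_ext => i j.
transitivity (c *: kmx X i j + kmx Y i j) => //.
case: X => [[[y s] h] [x r]]; case: Y => [[[y' s'] h'] [x' r']].
have T : topart (TD_val (c *: h + h')) = c *: topart h + topart h'.
  by rewrite -topart_linear.
move: i j; apply: ord3P; apply: ord3P; rewrite /= ?T ?(barD, barZ) //.
all: by rewrite ?scalerBr ?scalerN ?opprD //; zmod.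
Qed.

Lemma kder_linear : linear kder.
Proof. by move=> c X Y; rewrite /kder -dpart_linear. Qed.
End Kantor.

(** * The bracket in terms of matrices and derivations *)

Section KantorBracket.
Variables (F : fieldType) (A : structurableType F) (d : set (A -> A)).
Hypotheses (char2 : 2%N \notin [pchar F]) (char3 : 3%N \notin [pchar F]).
Hypotheses (d_sub : lie_subalgebra (der A) d) (d_inder : inder A `<=` d).
Local Notation K := (kantor d_sub).
Local Notation kbr := (kantor_bracket char2 char3 d_sub d_inder).
Implicit Types (X Y : K) (D E : A -> A) (a b : A).

Lemma gl_bracket_der_Top D a : d D -> gl_bracket D (Top a) = Top (D a).
Proof.
move=> dD; have [_ DM Db] := lie_sub d_sub dD.
apply/funext => z; rewrite glE !TopE.
by rewrite !(derD d_sub _ _ dD, derN d_sub _ dD, DM, Db, nmulE); zmod.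
Qed.

Lemma gl_bracket_TopD D E a b : d D -> d E ->
  gl_bracket (Top a + D) (Top b + E)
  = gl_bracket (Top a) (Top b) + (Top (D b) - Top (E a)) + gl_bracket D E.
Proof.
move=> dD dE; rewrite -!gl_bracket_der_Top //.
apply/funext => z; rewrite glE !addfE oppfE !glE.
rewrite (derD d_sub _ _ dD) (derD d_sub _ _ dE) !TopE.
by rewrite !nmulE; zmod.
Qed.

Lemma der0 D : d D -> D 0 = 0.
Proof.
by move=> dD; apply: (addrI (D 0)); rewrite -(derD d_sub) // !addr0.
Qed.

Lemma TD_valE X : TD_val X.1.2 = Top (topart (TD_val X.1.2)) + kder X.
Proof. by rewrite /kder /dpart addrCA subrr addr0. Qed.

Lemma dpart_gl_bracket D E a b : d D -> d E ->
  dpart (gl_bracket (Top a + D) (Top b + E))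
  = Dop a b *+ 2 - Dop (bar a) b + gl_bracket D E.
Proof.
move=> dD dE; rewrite gl_bracket_TopD //.
have dp (f1 f2 f3 f4 : A -> A) : dpart (f1 + (f2 - f3) + f4)
    = dpart f1 + (dpart f2 - dpart f3) + dpart f4.
  by rewrite !(raddfD (@dpart F A)) (raddfN (@dpart F A)).
rewrite dp (dpart_Top_Top char2 char3) !(dpart_Top char3) subrr addr0.
congr (_ + _); rewrite dpart_id // glE (der1 d_sub dD) (der1 d_sub dE).
by rewrite (der0 dD) (der0 dE) subrr.
Qed.

Lemma kder_bracket X Y :
  kder (kbr X Y) = gl_bracket (kder X) (kder Y)
    + 2%:R^-1 *: mtr (mprod (@Dop F A) (kmx X) (kmx Y)).
Proof.
have := dpart_gl_bracket (topart (TD_val X.1.2)) (topart (TD_val Y.1.2))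
  (kder_d char3 X) (kder_d char3 Y).
rewrite -!TD_valE; set D := kder X; set E := kder Y.
case: X @D => [[[y s] h] [x r]] D; case: Y @E => [[[y' s'] h'] [x' r']] E /=.
have [hs hr] := (skewP _ (valP s), skewP _ (valP r)).
have [hs' hr'] := (skewP _ (valP s'), skewP _ (valP r')).
set a := topart h; set b := topart h' => hh.
have -> : kder (kbr (y, s, h, (x, r)) (y', s', h', (x', r')))
  = dpart (gl_bracket h h' + (Vop x y' + (Lop (val r) \o Lop (val s')))
    - (Vop x' y + (Lop (val r') \o Lop (val s)))) by [].
have dp (f1 f2 f3 f4 f5 : A -> A) : dpart (f1 + (f2 + f3) - (f4 + f5))
    = dpart f1 + (dpart f2 + dpart f3) - (dpart f4 + dpart f5).
  by rewrite (raddfB (@dpart F A)) !(raddfD (@dpart F A)).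
(* The equation is doubled, since L_r L_s has a known derivation part only after doubling. The
   diagonal of the trace gives 4 D_{a,b} - 2 D_{bar a,b}, and the off-diagonal terms in x and y pair
   up by the symmetries of D. *)
have half (V : lmodType F) (p q g u v l m e f t : V) :
    l *+ 2 = e -> m *+ 2 = f ->
    t = p *+ 4 - q *+ 2 + (u *+ 2 + e) - (v *+ 2 + f) ->
    p *+ 2 - q + g + (u + l) - (v + m) = g + 2%:R^-1 *: t.
  move=> <- <- ->; apply: (mul2_inj char2).
  by rewrite [RHS]mulrnDl half2 //; zmod.
rewrite dp hh !(dpart_Vop char3).
apply: half (dpart_LL char2 char3 hr hs') (dpart_LL char2 char3 hr' hs) _.
rewrite /mtr sum3 /mprod !sum3 /= -/a -/b.
rewrite !(DopDl, DopDr, DopNl, DopNr) !Dop_bar //.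
have barl (u v : A) : Dop (bar u) v = Dop u (bar v).
  by have := Dop_bar char2 u (bar v); rewrite barK.
have -> : Dop x' (bar y) = - Dop y (bar x').
  by rewrite (DopC char2 (bar y)) barl.
rewrite !barl (DopC char2 (val s) (val r')).
by zmod.
Qed.

Lemma mbr_jskew X Y : jskew (mbr (kmx X) (kder X) (kmx Y) (kder Y)).
Proof.
have jder X0 Y0 : jskew (mmap (kder X0) (kmx Y0)).
  have [Dl _ Db] := lie_sub d_sub (kder_d char3 X0).
  by apply: jskew_map (kmx_jskew Y0).
apply: jskewD; last exact/jskewN/jder.
apply: jskewD; last exact: jder.
by apply/jskew_traceless/jskew_mcomm; first exact: char3; apply: kmx_jskew.
Qed.

Lemma kmx_bracket X Y :
  kmx (kbr X Y) = mbr (kmx X) (kder X) (kmx Y) (kder Y).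
Proof.
have dX := kder_d char3 X; have dY := kder_d char3 Y.
have X1 := der1 d_sub dX; have Y1 := der1 d_sub dY.
have XN z := derN d_sub z dX; have YN z := derN d_sub z dY.
have XD u v := derD d_sub u v dX; have YD u v := derD d_sub u v dY.
have [[_ _ XB] [_ _ YB]] := (lie_sub d_sub dX, lie_sub d_sub dY).
have fX := dpartE (TD_val X.1.2); have fY := dpartE (TD_val Y.1.2).
have {fX} fX z : TD_val X.1.2 z = topart (TD_val X.1.2) ** z
  + (z ** topart (TD_val X.1.2) - z ** bar (topart (TD_val X.1.2)))
  + kder X z by rewrite fX !nmulE.
have {fY} fY z : TD_val Y.1.2 z = topart (TD_val Y.1.2) ** z
  + (z ** topart (TD_val Y.1.2) - z ** bar (topart (TD_val Y.1.2)))
  + kder Y z by rewrite fY !nmulE.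
set Z := mcomm (kmx X) (kmx Y); set t := 3%:R^-1 *: mtr Z.
have ZE i j : mbr (kmx X) (kder X) (kmx Y) (kder Y) i j = Z i j
  - mscal t i j + kder X (kmx Y i j) - kder Y (kmx X i j) by [].
have Z0 i j : Z i j =
  \sum_k kmx X i k ** kmx Y k j - \sum_k kmx Y i k ** kmx X k j by [].
have t3 : t *+ 3 = Z i0 i0 + Z i1 i1 + Z i2 i2.
  by rewrite third3 // /mtr sum3.
have tb : bar t = - t.
  rewrite /t barZ /mtr sum3 -scalerN; congr (_ *: _).
  have sZ i : bar (Z i i) = - Z (rev_ord i) (rev_ord i).
    by rewrite /Z (jskew_mcomm (kmx_jskew X) (kmx_jskew Y)) opprK.
  by rewrite 2!barD !sZ !rev3; zmod.
(* Five entries remain: (0,0) for the T_A component, the only one that meets the trace, then (0,1)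
   and (0,2) for n, and (2,0) and (2,1) for its copy. *)
apply: (jskew_eq (kmx_jskew _) (mbr_jskew _ _)); rewrite ZE Z0.
- rewrite [mscal _ _ _]/= !sum3; move: t3; rewrite !Z0 !sum3.
  clear ZE Z0; clearbody t.
  move: fX fY X1 Y1 XN YN XD YD XB YB tb; clear -char3.
  move: (kder X) (kder Y) => D E.
  case: X => [[[y s] h] [x r]]; case: Y => [[[y' s'] h'] [x' r']] /=.
  (* The T_A component c is read off at 1, where T_c takes the value 2c - [bar c]. As [t] is skew,
     it enters this value as -3t, which [t3] turns into diagonal entries. *)
  move=> fX fY X1 Y1 XN YN XD YD XB YB tb t3; apply: (topart_eq char3).
  have [hs hr] := (skewP _ (valP s), skewP _ (valP r)).
  have [hs' hr'] := (skewP _ (valP s'), skewP _ (valP r')).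
  apply: (subr_eq_trans t3) => {t3}.
  rewrite !(addfE, oppfE) /Lop /= glE.
  rewrite !fX !fY X1 Y1 !addr0 /Vop !nmulE (_ : mscal t i0 i0 = t) //.
  rewrite !(XD, YD, XN, YN) !(barE, nmulE) -!XB -!YB.
  rewrite tb hs hs' hr hr' !(nmulE, addr0).
  by zmod.
- rewrite [mscal _ _ _]/= subr0 !sum3.
  move: fX fY X1 Y1 XN YN; clear.
  move: (kder X) (kder Y) => D E.
  case: X => [[[y s] h] [x r]]; case: Y => [[[y' s'] h'] [x' r']] /=.
  move=> fX fY X1 Y1 XN YN.
  by rewrite fX fY !nmulE; zmod.
- rewrite [mscal _ _ _]/= subr0 !sum3.
  move: fX fY X1 Y1 XN YN; clear.
  move: (kder X) (kder Y) => D E.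
  case: X => [[[y s] h] [x r]]; case: Y => [[[y' s'] h'] [x' r']] /=.
  move=> fX fY X1 Y1 XN YN.
  have [hs hr] := (skewP _ (valP s), skewP _ (valP r)).
  have [hs' hr'] := (skewP _ (valP s'), skewP _ (valP r')).
  rewrite /del /Rop !addfE !fX !fY X1 Y1 !addr0.
  rewrite !(nmulE, barE, XN, YN, hs, hr, hs', hr').
  by zmod.
- rewrite [mscal _ _ _]/= subr0 !sum3.
  move: fX fY X1 Y1 XN YN; clear.
  move: (kder X) (kder Y) => D E.
  case: X => [[[y s] h] [x r]]; case: Y => [[[y' s'] h'] [x' r']] /=.
  move=> fX fY X1 Y1 XN YN.
  have [hs hr] := (skewP _ (valP s), skewP _ (valP r)).
  have [hs' hr'] := (skewP _ (valP s'), skewP _ (valP r')).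
  rewrite /eps /del /Rop !(addfE, oppfE) !TopE !fX !fY X1 Y1 !addr0.
  rewrite !(nmulE, barE, XN, YN, hs, hr, hs', hr').
  by zmod.
- rewrite [mscal _ _ _]/= subr0 !sum3.
  move: fX fY X1 Y1 XN YN; clear.
  move: (kder X) (kder Y) => D E.
  case: X => [[[y s] h] [x r]]; case: Y => [[[y' s'] h'] [x' r']] /=.
  move=> fX fY X1 Y1 XN YN.
  have [hs hr] := (skewP _ (valP s), skewP _ (valP r)).
  have [hs' hr'] := (skewP _ (valP s'), skewP _ (valP r')).
  rewrite /eps !(addfE, oppfE) !TopE !fX !fY X1 Y1 !addr0.
  rewrite !(nmulE, barE, XN, YN, hs, hr, hs', hr').
  by zmod.
Qed.
End KantorBracket.

(** * Orthogonal matrices act by automorphisms *)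

Section Conjugation.
Variables (F : fieldType) (A : structurableType F) (d : set (A -> A)).
Hypotheses (char2 : 2%N \notin [pchar F]) (char3 : 3%N \notin [pchar F]).
Hypotheses (d_sub : lie_subalgebra (der A) d) (d_inder : inder A `<=` d).
Local Notation K := (kantor d_sub).
Local Notation kbr := (kantor_bracket char2 char3 d_sub d_inder).
Implicit Types (X Y : K) (M N : 'M[F]_3).

Definition kconj M N X : K :=
  rebuild d_sub (conjm M N (kmx X)) (kder_d char3 X).

(** Membership of M in the orthogonal group of J: its inverse N is also its reflection in the
    antidiagonal, the adjoint for J. *)
Definition orthogonal_pair M N :=
  N *m M = 1%:M /\ forall i j, N (rev_ord j) (rev_ord i) = M i j.

Lemma kmx_kconj M N X : orthogonal_pair M N ->
  kmx (kconj M N X) = conjm M N (kmx X).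
Proof.
move=> [NM sMN]; apply: kmx_rebuild => //.
exact: jskew_conjm NM sMN (kmx_jskew X).
Qed.

Lemma kder_kconj M N X : kder (kconj M N X) = kder X.
Proof. exact: kder_rebuild. Qed.

Lemma kconjM M N M' N' X : orthogonal_pair M N -> orthogonal_pair M' N' ->
  kconj (M *m M') (N' *m N) X = kconj M N (kconj M' N' X).
Proof.
move=> o o'; have oo : orthogonal_pair (M *m M') (N' *m N).
  have [NM sMN] := o; have [NM' sMN'] := o'; split.
    by rewrite mulmxA -(mulmxA N') NM mulmx1.
  move=> i j; rewrite !mxE (reindex_inj rev_ord_inj); apply: eq_bigr => k _ /=.
  by rewrite sMN sMN' mulrC.
by apply: kantor_eq; rewrite ?kder_kconj // !kmx_kconj // conjmM.
Qed.

Lemma kconj1 X : kconj 1%:M 1%:M X = X.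
Proof.
apply: kantor_eq; rewrite ?kder_kconj // kmx_kconj ?conjm1 //.
split=> [|i j]; first exact: mulmx1.
by rewrite !mxE (inj_eq rev_ord_inj) eq_sym.
Qed.

(** Each ingredient of the bracket is equivariant: in products the inner N M cancels, the trace is
    invariant, [mscal] is fixed, and linear maps applied entrywise commute with scalar matrices. *)
Lemma mbr_conjm M N (U V : 'I_3 -> 'I_3 -> A) (D E : {linear A -> A}) :
  N *m M = 1%:M ->
  mbr (conjm M N U) D (conjm M N V) E = conjm M N (mbr U D V E).
Proof.
move=> NM; have MN := mulmx1C NM.
have C : mcomm (conjm M N U) (conjm M N V) = conjm M N (mcomm U V).
  have l := @nmul_linearl F A; have r := @nmul_linearr F A.
  by rewrite /mcomm !(mprod_conjm l r _ _ NM) raddfB.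
rewrite /mbr /traceless C mtr_conjm //; set S := mscal _; set Z := mcomm U V.
have -> : conjm M N (Z - S + mmap D V - mmap E U) = conjm M N Z
    - conjm M N S + conjm M N (mmap D V) - conjm M N (mmap E U).
  by rewrite (raddfB (conjm M N)) (raddfD (conjm M N)) -(raddfB (conjm M N)).
by rewrite conjm_scal // !conjm_map.
Qed.

Lemma kconj_aut M N : orthogonal_pair M N -> is_aut kbr (kconj M N).
Proof.
move=> o; have [NM sMN] := o; have MN := mulmx1C NM; split.
- move=> c X Y; apply: kantor_eq.
    by rewrite kmx_kconj // !kmx_linear !kmx_kconj // linearP.
  by rewrite kder_kconj !kder_linear !kder_kconj.
- have o' : orthogonal_pair N M by split=> // i j; rewrite -sMN !rev_ordK.
  by exists (kconj N M) => X; rewrite -kconjM // ?NM ?MN kconj1.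
- move=> X Y; have lin (Z : K) : {D : {linear A -> A} | kder Z = D :> (A -> A)}.
    have [Dl _ _] := lie_sub d_sub (kder_d char3 Z).
    pose B := GRing.isLinear.Build F A A *:%R (kder Z) Dl.
    by exists (HB.pack_for {linear A -> A} (kder Z) B).
  apply: kantor_eq.
    rewrite kmx_kconj // !kmx_bracket !kmx_kconj // !kder_kconj.
    have [D ->] := lin X; have [E ->] := lin Y.
    by rewrite mbr_conjm.
  rewrite kder_kconj !kder_bracket !kmx_kconj // !kder_kconj.
  by rewrite (mprod_conjm (@Dop_linearl F A) (@Dop_linearr F A)) // mtr_conjm.
Qed.
End Conjugation.

(** * The symmetric group in the orthogonal group *)

Section Octahedral.
Variables (F : fieldType) (i : F).
Hypotheses (char2 : 2%N \notin [pchar F]) (ii : i ^+ 2 = -1).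

Definition signF (b : bool) : F := if b then -1 else 1.
(* The sign vectors [(a, b, c) / 2] with [c = a b] are the rows of a 4 x 3 matrix
   with orthonormal columns orthogonal to [(1, 1, 1, 1)]; the rows below are
   their coordinates in a basis where the sum of three squares becomes [J]. *)
Definition vert (k : 'I_4) : 'rV[F]_3 :=
  let a := signF (2 <= k)%N in let b := signF (odd k) in let c := a * b in
  \row_(j < 3) match val j with
  | 0 => (a - i * c) / 4%:R | 1 => b / 2%:R | _ => (a + i * c) / 2%:R
  end.

Definition Wr : 'M[F]_(4, 3) := \matrix_(k, j) vert k 0 j.
(** The adjoint of [Wr] for the form J and the standard form on F^4. With [Av] the projection onto
    the line of (1,1,1,1), [Wr] is an isometry onto the orthogonal of that line. *)
Definition Wl : 'M[F]_(3, 4) := \matrix_(j, k) Wr k (rev_ord j).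
Definition Av : 'M[F]_4 := const_mx 4%:R^-1.

Lemma four_neq0 : 4%:R != 0 :> F.
Proof. by rewrite (natrM _ 2 2) mulf_neq0 // pchar_neq0. Qed.

Lemma sum4 (V : nmodType) (G : 'I_4 -> V) : \sum_k G k =
  G (@Ordinal 4 0 isT) + G (@Ordinal 4 1 isT)
  + G (@Ordinal 4 2 isT) + G (@Ordinal 4 3 isT).
Proof.
rewrite !big_ord_recl big_ord0 addr0 !addrA.
by congr (G _ + G _ + G _ + G _); apply: val_inj.
Qed.

Lemma ord4P (P : 'I_4 -> Prop) : P (@Ordinal 4 0 isT) -> P (@Ordinal 4 1 isT) ->
  P (@Ordinal 4 2 isT) -> P (@Ordinal 4 3 isT) -> forall k, P k.
Proof.
by move=> p0 p1 p2 p3 [[|[|[|[|//]]]] p]; rewrite (bool_irrelevance p isT).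
Qed.

Lemma Wl_Wr : Wl *m Wr = 1%:M.
Proof.
have n2 := pchar_neq0 char2 isT; have n4 := four_neq0.
apply/matrixP; apply: ord3P; apply: ord3P; rewrite !mxE sum4 !mxE /= /signF.
all: field: ii; by rewrite ?n2 ?n4.
Qed.

Lemma Wr_Wl : Wr *m Wl = 1%:M - Av.
Proof.
have n2 := pchar_neq0 char2 isT; have n4 := four_neq0.
apply/matrixP; apply: ord4P; apply: ord4P; rewrite !mxE sum3 !mxE /= /signF.
all: field: ii; by rewrite ?n2 ?n4.
Qed.
Lemma Av_perm (s : 'S_4) : (perm_mx s *m Av = Av) * (Av *m perm_mx s = Av).
Proof.
split; first by rewrite -row_permE; apply/matrixP => k l; rewrite !mxE.
by rewrite -[s]invgK -col_permE; apply/matrixP => k l; rewrite !mxE.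
Qed.

Lemma Wl_Av : Wl *m Av = 0.
Proof.
have := congr1 (mulmx Wl) Wr_Wl; rewrite mulmxA Wl_Wr mul1mx mulmxBr mulmx1.
by move=> h; rewrite -[LHS](subKr Wl) -h subrr.
Qed.

Definition rho (s : 'S_4) : 'M[F]_3 := Wl *m perm_mx s *m Wr.

Lemma rho1 : rho 1%g = 1%:M.
Proof. by rewrite /rho perm_mx1 mulmx1 Wl_Wr. Qed.

(** The middle factor [Wr *m Wl] is 1 - [Av]; the [Av] term dies because permutations fix [Av] and
    [Wl] kills it. *)
Lemma rhoM s t : rho (s * t)%g = rho s *m rho t.
Proof.
rewrite /rho !mulmxA -[in RHS](mulmxA (Wl *m perm_mx s)) Wr_Wl mulmxBr mulmx1.
by rewrite -(mulmxA Wl _ Av) Av_perm Wl_Av subr0 perm_mxM mulmxA.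
Qed.

(** Permutation matrices are orthogonal on F^4, and [Wl] is the adjoint of [Wr]; in coordinates this
    is a reindexing of the sum by [s]. *)
Lemma rho_pair s : orthogonal_pair (rho s) (rho s^-1%g).
Proof.
split; first by rewrite -rhoM mulVg rho1.
have rhoE t j l : rho t j l = \sum_k Wr k (rev_ord j) * Wr (t k) l.
  rewrite /rho -mulmxA mxE; apply: eq_bigr => k _.
  by rewrite -row_permE [Wl _ _]mxE [row_perm _ _ _ _]mxE.
move=> j l; rewrite !rhoE (reindex_inj (@perm_inj _ s)); apply: eq_bigr => k _.
by rewrite rev_ordK permK mulrC.
Qed.

(* The 3-cycle on the complement of [m], as a skew matrix. Its only zero row is
   the row [m], so a permutation that preserves it fixes [m]. *)
Definition cyc (m k l : nat) : int :=
  if (k == m) || (l == m) then 0 else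
  let p := unbump m k in let q := unbump m l in
  if q == (p.+1 %% 3)%N then 1 else if p == (q.+1 %% 3)%N then -1 else 0.

Definition cycm (m : 'I_4) : 'M[F]_4 := \matrix_(k, l) (cyc m k l)%:~R.

Lemma cycm_skew m k l : cycm m l k = - cycm m k l.
Proof.
rewrite !mxE -mulrNz; congr _%:~R.
by move: m k l; do 3!apply: ord4P.
Qed.

(** Every row is null or has one 1 and one -1, so its sum is zero. With the same fact for columns,
    [cycm m] loses nothing when compressed to the orthogonal of (1,1,1,1). *)
Lemma cycm_Av m : cycm m *m Av = 0.
Proof.
apply/matrixP => k l; rewrite !mxE sum4 !mxE -!mulrDl -!mulrzDr.
rewrite (_ : _ + _ + _ + _ = 0 :> int) ?mulr0z ?mul0r //.
by move: m k {l}; do 2!apply: ord4P.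
Qed.

Lemma Av_cycm m : Av *m cycm m = 0.
Proof.
apply/matrixP => k l; rewrite !mxE sum4 !mxE -!mulrDr -!mulrzDr.
rewrite (_ : _ + _ + _ + _ = 0 :> int) ?mulr0z ?mulr0 //.
by move: m l {k}; do 2!apply: ord4P.
Qed.

Lemma cycm_row m k : k != m -> exists l, cycm m k l = 1.
Proof.
move=> km; suff [l cl] : exists l : 'I_4, cyc m k l = 1.
  by exists l; rewrite mxE cl.
by elim/ord4P: m km; elim/ord4P: k => //= _;
  (do ?[by exists (@Ordinal 4 0 isT) | by exists (@Ordinal 4 1 isT)
  | by exists (@Ordinal 4 2 isT) | by exists (@Ordinal 4 3 isT)]).
Qed.

(** Test elements for faithfulness: being J-skew of trace zero over F, they give elements of the
    Kantor algebra with derivation part 0. *)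
Definition cyc3 (m : 'I_4) : 'M[F]_3 := Wl *m cycm m *m Wr.

Lemma cyc3_skew m j l : cyc3 m (rev_ord l) (rev_ord j) = - cyc3 m j l.
Proof.
have E a b : cyc3 m a b =
    \sum_p \sum_q Wr p (rev_ord a) * cycm m p q * Wr q b.
  rewrite /cyc3 -mulmxA mxE; apply: eq_bigr => p _.
  rewrite [X in _ * X]mxE mulr_sumr; apply: eq_bigr => q _.
  by rewrite [Wl _ _]mxE mulrA.
rewrite !E exchange_big -sumrN; apply: eq_bigr => p _.
rewrite -sumrN; apply: eq_bigr => q _.
by rewrite rev_ordK (cycm_skew m p q); ring.
Qed.

Lemma cyc3_tr m : \tr (cyc3 m) = 0.
Proof.
rewrite /cyc3 mxtrace_mulC mulmxA Wr_Wl mulmxBl mul1mx Av_cycm subr0.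
apply: big1 => k _; rewrite mxE (_ : cyc m k k = 0) //.
by elim/ord4P: m; elim/ord4P: k.
Qed.

Lemma rho_cyc3 s m : rho s *m cyc3 m = Wl *m (perm_mx s *m cycm m) *m Wr.
Proof.
rewrite /rho /cyc3 !mulmxA -[in LHS](mulmxA _ Wr Wl) Wr_Wl mulmxBr mulmx1.
by rewrite mulmxBl -[X in _ - X]mulmxA Av_cycm mulmx0 subr0.
Qed.

Lemma cyc3_rho s m : cyc3 m *m rho s = Wl *m (cycm m *m perm_mx s) *m Wr.
Proof.
rewrite /rho /cyc3 !mulmxA -[in LHS](mulmxA _ Wr Wl) Wr_Wl mulmxBr mulmx1.
by rewrite -(mulmxA Wl _ Av) cycm_Av mulmx0 subr0.
Qed.

Lemma Wr_conj (X : 'M[F]_4) : X *m Av = 0 -> Av *m X = 0 ->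
  Wr *m (Wl *m X *m Wr) *m Wl = X.
Proof.
move=> XA AX; rewrite -!mulmxA Wr_Wl mulmxBr XA mulmx1 subr0.
by rewrite mulmxA Wr_Wl mulmxBl AX mul1mx subr0.
Qed.

Lemma rho_faithful s :
  (forall m, rho s *m cyc3 m = cyc3 m *m rho s) -> s = 1%g.
Proof.
move=> com; apply/permP => m; rewrite perm1; apply/eqP.
have {}com : perm_mx s *m cycm m = cycm m *m perm_mx s.
  have := com m; rewrite rho_cyc3 cyc3_rho => h.
  rewrite -[LHS]Wr_conj ?h ?Wr_conj //.
  - by rewrite -mulmxA Av_perm cycm_Av.
  - by rewrite mulmxA Av_cycm mul0mx.
  - by rewrite -mulmxA cycm_Av mulmx0.
  - by rewrite mulmxA Av_perm Av_cycm.
(* If [s] moves [m], row [m] of the left side of [com] is row [s m] of [cycm m], which contains a 1,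
   whereas row [m] of the right side is a permutation of the null row [m]. *)
apply/negPn/negP => sm; have [l cl] := cycm_row sm.
have := congr1 (fun X : 'M_4 => X m l) com; rewrite -row_permE -[s in RHS]invgK.
rewrite -col_permE !mxE -[(cyc _ _ _)%:~R]/(_) => h.
have := oner_eq0 F; rewrite -cl mxE h /cyc eqxx mulr0z eqxx.
by [].
Qed.
End Octahedral.

(** * Faithfulness of the action on the Kantor algebra *)

Section Faithful.
Variables (F : fieldType) (A : structurableType F) (d : set (A -> A)).
Hypotheses (char2 : 2%N \notin [pchar F]) (char3 : 3%N \notin [pchar F]).
Hypotheses (d_sub : lie_subalgebra (der A) d).

Definition scalar_entries (Z : 'M[F]_3) : 'I_3 -> 'I_3 -> A :=
  fun j l => Z j l *: none.

Lemma conjm_scalar (M N Z : 'M[F]_3) :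
  conjm M N (scalar_entries Z) = scalar_entries (M *m Z *m N).
Proof.
apply: mx_ext => j l; rewrite /conjm /lmul /rmul /scalar_entries -mulmxA mxE.
rewrite scaler_suml; apply: eq_bigr => k _; rewrite mxE -scalerA.
rewrite scaler_suml; congr (_ *: _).
by apply: eq_bigr => q _; rewrite scalerA mulrC.
Qed.

Lemma scalar_entries_inj : injective scalar_entries.
Proof.
move=> Z Z' e; apply/matrixP => j l.
have /eqP := congr1 (fun U : 'I_3 -> 'I_3 -> A => U j l) e.
rewrite /scalar_entries -subr_eq0 -scalerBl scaler_eq0 (negPf (@none_neq0 _ A)).
by rewrite orbF subr_eq0 => /eqP.
Qed.

(** The matrix Z times the unit of A, with derivation 0, is an element of the algebra; fixing it
    means M Z N = Z, and N is the inverse of M. *)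
Lemma kconj_faithful (M N Z : 'M[F]_3) : orthogonal_pair M N ->
  (forall j l, Z (rev_ord l) (rev_ord j) = - Z j l) -> \tr Z = 0 ->
  (forall X : kantor d_sub, kconj char3 M N X = X) -> M *m Z = Z *m M.
Proof.
move=> o sZ tZ fixX; have [NM _] := o.
have jZ : jskew (scalar_entries Z).
  split; last by rewrite /mtr /scalar_entries -scaler_suml -/(\tr Z) tZ scale0r.
  by move=> j l; rewrite /scalar_entries sZ barZ bar1 scaleNr.
have d0 := lie_sub0 d_sub.
have := congr1 (@kmx F A d d_sub) (fixX (rebuild d_sub (scalar_entries Z) d0)).
rewrite kmx_kconj // !(kmx_rebuild char2 char3) // conjm_scalar.
by move=> /scalar_entries_inj {2}<-; rewrite -[RHS]mulmxA NM mulmx1.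
Qed.
End Faithful.

Theorem corollary4p5 (F : fieldType)
    (char2 : 2%N \notin [pchar F]) (char3 : 3%N \notin [pchar F])
    (sqrtN1 : exists i : F, i ^+ 2 = -1)
    (A : structurableType F) (d : set (A -> A))
    (d_sub : lie_subalgebra (der A) d) (d_inder : inder A `<=` d) :
  let AutK := LieAut (kantor_bracket char2 char3 d_sub d_inder) in
  exists H : {pred AutK}, group_closed H /\
  exists phi : 'S_4 -> AutK,
    [/\ {morph phi : s t / (s * t)%g}, injective phi & H =i codom phi].
Proof.
move=> AutK; have [i ii] := sqrtN1; have o := rho_pair char2 ii.
pose phi s : AutK := mkLieAut (kconj_aut char2 char3 d_sub d_inder (o s)).
have phiE s X : aut_val (phi s) X = kconj char3 (rho i s) (rho i s^-1%g) X.
  by [].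
have phiM : {morph phi : s t / (s * t)%g}.
  move=> s t; apply: val_inj; apply/funext => X.
  rewrite [LHS]phiE invMg !(rhoM char2 ii).
  exact: kconjM (o s) (o t).
have phi1 : phi 1%g = 1%g.
  by apply: (mulgI (phi 1%g)); rewrite -phiM !mulg1.
have phiV s : phi s^-1%g = (phi s)^-1%g.
  by apply: (mulgI (phi s)); rewrite -phiM !mulgV.
exists (fun f => f \in codom phi); split.
  split; first by rewrite -[_ \in _]/(1%g \in codom phi) -phi1 codom_f.
  by move=> _ _ /codomP[s ->] /codomP[t ->]; rewrite -phiV -phiM; apply: codom_f.
exists phi; split=> // s t st.
(* The permutation s t^-1 acts trivially, so its matrix commutes with every test element
   [cyc3 m]. *)
apply/eqP; rewrite eq_mulgV1; apply/eqP/(rho_faithful char2 ii) => m.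
apply: (kconj_faithful char2 (d_sub := d_sub) (o _)).
- exact: cyc3_skew.
- exact: cyc3_tr.
- by move=> X; rewrite -phiE phiM phiV st mulgV.
Qed.
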